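(* Let $S$ be a $\vee$-semilattice with minimum $0$ and let $\prec$ be any binary relation on $S$. Then the spectrum $\widehat{S}$ of $(S,\leq,\prec)$ is a sober space.
   Context: A $\vee$-semilattice is a poset $(S,\leq)$ with binary joins $\vee$. A filter is a non-empty $F\subseteq S$ such that for all $p,q\in S$: $p,q\in F$ iff there is $r\in F$ with $r\leq p$ and $r\leq q$. An ideal is a non-empty $I\subseteq S$ such that for all $p,q\in S$: $p,q\in I$ iff there is $r\in I$ with $r\geq p$ and $r\geq q$. A filter $P$ is prime if $S\setminus P$ is an ideal; it is proper if $P\neq S$; it is round if for every $p\in P$ there is $r\in P$ with $r\prec p$. The spectrum of $(S,\leq,\prec)$ is the set $\widehat{S}$ of all proper round prime filters $P\subseteq S$, with the topology generated by the sets $\widehat{S}_p=\{P\in\widehat{S}:p\in P\}$, $p\in S$. A closed set $C\subseteq X$ of a topological space is irreducible if its proper closed subsets form an ideal (with respect to inclusion; in particular $C\neq\emptyset$). A space $X$ is sober if for every irreducible closed $C\subseteq X$ there is a unique point $x$ with $C=\mathrm{cl}\{x\}$. *)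

(* Defs.v *)
From HB Require Import structures.
From mathcomp Require Import all_boot all_order.
From mathcomp Require Import boolp classical_sets topology.

Set Implicit Arguments.
Unset Strict Implicit.
Unset Printing Implicit Defensive.

Import Order.TTheory.
Local Open Scope classical_set_scope.
Local Open Scope order_scope.

(* Filters and ideals take the order as a plain relation, so that they apply
   both to a [porderType] and to the closed subsets of a topological space. *)
Section FilterIdeal.
Context {T : Type} (le : T -> T -> Prop).

Definition is_filter (F : set T) : Prop :=
  F !=set0 /\ forall p q, (F p /\ F q) <-> exists2 r, F r & le r p /\ le r q.

Definition is_ideal (I : set T) : Prop :=
  I !=set0 /\ forall p q, (I p /\ I q) <-> exists2 r, I r & le p r /\ le q r.

Definition is_prime (P : set T) : Prop := is_filter P /\ is_ideal (~` P).

End FilterIdeal.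

Definition is_round {T : Type} (prec : T -> T -> Prop) (P : set T) : Prop :=
  forall p, P p -> exists2 r, P r & prec r p.

Definition ple {d : Order.disp_t} (S : porderType d) : S -> S -> Prop :=
  fun p q => p <= q.

Record spectrum {d : Order.disp_t} {S : porderType d} (prec : S -> S -> Prop) :=
  Spectrum {
    spec_set :> set S ;
    spec_proper : spec_set <> setT ;
    spec_round : is_round prec spec_set ;
    spec_prime : is_prime (@ple d S) spec_set }.

Section SpectrumTopology.
Context {d : Order.disp_t} {S : porderType d} (prec : S -> S -> Prop).

Definition spec_open (p : S) : set (spectrum prec) := [set P | spec_set P p].

HB.instance Definition _ := gen_eqMixin (spectrum prec).
HB.instance Definition _ := gen_choiceMixin (spectrum prec).
HB.instance Definition _ :=
  isSubBaseTopological.Build (spectrum prec) (range spec_open) id.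

End SpectrumTopology.

Arguments spec_open {d S} prec p _.

Definition closed_le {X : topologicalType} (A B : {A : set X | closed A}) : Prop :=
  sval A `<=` sval B.

(* [`<`] is strict inclusion. *)
Definition irreducible_closed {X : topologicalType} (C : set X) : Prop :=
  closed C /\ is_ideal closed_le [set D | sval D `<` C].

Definition sober (X : topologicalType) : Prop :=
  forall C : set X, irreducible_closed C -> exists! x : X, C = closure [set x].

(* Main.v *)
(** Call [P], the set of all [p] such that [spec_open p] meets the irreducible
    closed set [C], the trace of [C].  It is a filter because, by
    irreducibility, two basic open sets that meet [C] meet simultaneously
    inside [C]; properness, roundness and primality are inherited from the
    points of [C].  A spectrum point lies in the closure of [{P}] iff it is
    contained in [P], so [C] is included in this closure; and [P] is in [C]
    because every basic neighbourhood of [P] meets [C] by construction. *)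

Require Import Defs.
From mathcomp Require Import all_boot all_order.
From mathcomp Require Import boolp classical_sets topology.
From mathcomp Require Import filter.

Set Implicit Arguments.
Unset Strict Implicit.
Unset Printing Implicit Defensive.

Import Order.TTheory.
Local Open Scope classical_set_scope.
Local Open Scope order_scope.

Lemma irreducible_closed_nonempty {X : topologicalType} (C : set X) :
  irreducible_closed C -> C !=set0.
Proof.
move=> [_ [[D [_ nCD]] _]]; apply/set0P/eqP => C0.
by apply: nCD; rewrite C0.
Qed.

(** [C] minus [U] and [C] minus [V] are proper closed subsets of [C], so the ideal property puts
    both inside one proper closed subset [E]; a point of [C] outside [E] lies in [U] and in [V]. *)
Lemma irreducible_closed_openI {X : topologicalType} (C U V : set X) :
  irreducible_closed C -> open U -> open V ->
  C `&` U !=set0 -> C `&` V !=set0 -> C `&` (U `&` V) !=set0.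
Proof.
move=> [cC [_ dirC]] oU oV [x [Cx Ux]] [y [Cy Vy]].
have cD (W : set X) : open W -> closed (C `&` ~` W).
  by move=> oW; apply: closedI => //; exact: open_closedC.
have pD (W : set X) z : C z -> W z -> C `&` ~` W `<` C.
  by move=> Cz Wz; split=> [|sub]; [exact: subIsetl | have [] := sub z Cz].
have [[E cE] /= [_ EC] [UE VE]] := (dirC (exist _ _ (cD U oU))
  (exist _ _ (cD V oV))).1 (conj (pD U x Cx Ux) (pD V y Cy Vy)).
have [z Cz nEz] : exists2 z, C z & ~ E z.
  by apply: contrapT => nz; apply: EC => z Cz; apply: contrapT => ?; apply: nz; exists z.
exists z; split=> //; split; apply: contrapT => nW; apply: nEz.
- exact: UE.
- exact: VE.
Qed.

Section Spectrum.
Context {d : Order.disp_t}.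

Lemma spectrum_eq {S : porderType d} (prec : S -> S -> Prop)
    (P Q : spectrum prec) :
  spec_set P = spec_set Q -> P = Q.
Proof.
case: P Q => [P p1 p2 p3] [Q q1 q2 q3] /= PQ; subst Q.
by congr Spectrum; exact: Prop_irrelevance.
Qed.

Lemma filter_up {S : porderType d} (F : set S) (p q : S) :
  is_filter (@ple d S) F -> F p -> p <= q -> F q.
Proof.
move=> [_ fF] Fp pq.
suff /(fF p q).2 [] : exists2 r, F r & ple r p /\ ple r q by [].
by exists p; rewrite // /ple lexx.
Qed.

Lemma spec_open_open {S : porderType d} (prec : S -> S -> Prop) (p : S) :
  open (spec_open prec p).
Proof.
exists [set spec_open prec p]; last by rewrite bigcup_set1.
by move=> _ ->; apply: finI_from1; exists p.
Qed.

(** The subbase is already a base: since points are filters, two subbasic neighbourhoods of [P]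
    contain a third, given by a common lower bound in [P]. *)
Lemma nbhs_spectrum {S : porderType d} (prec : S -> S -> Prop)
    (P : spectrum prec) (A : set (spectrum prec)) :
  nbhs P A <-> exists2 p, spec_set P p & spec_open prec p `<=` A.
Proof.
have [[[p0 Pp0] fP] _] := spec_prime P.
(* Once [F] is a filter, it absorbs the finite intersections of the generated topology; [p0] takes
   care of the empty one. *)
pose F := [set B | exists2 p, spec_set P p & spec_open prec p `<=` B].
have FF : Filter F.
  split=> [|B C [p Pp pB] [q Pq qC]|B C BC [p Pp pB]]; first by exists p0.
  - have [r Pr [rp rq]] := (fP p q).1 (conj Pp Pq); exists r => // Q Qr.
    have [fQ _] := spec_prime Q.
    by split; [exact: pB (filter_up fQ Qr rp)|exact: qC (filter_up fQ Qr rq)].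
  - by exists p => //; exact: subset_trans BC.
rewrite nbhsE /=; split=> [|[p Pp pA]]; last first.
  by exists (spec_open prec p) => //; split=> //; exact: spec_open_open.
move=> [B [[Bs sBs <-] [b Bb Pb]] BA].
have bA : b `<=` A by move=> x bx; apply: BA; exists b.
apply: (@filterS _ F FF _ _ bA).
have [D sD Db] := sBs b Bb; rewrite -Db; apply: filter_bigI => U DU.
have /set_mem [p _ pU] := sD U DU; exists p; last by rewrite pU.
by move: Pb; rewrite -Db => /(_ U DU); rewrite /= -pU.
Qed.

Lemma closure_spectrum1 {S : porderType d} (prec : S -> S -> Prop)
    (P Q : spectrum prec) :
  closure [set P] Q <-> spec_set Q `<=` spec_set P.
Proof.
split=> [clQ p Qp|QP A /nbhs_spectrum [p Qp pA]]; last first.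
  by exists P; split=> //; apply/pA/QP.
have nQ : nbhs Q (spec_open prec p) by apply/nbhs_spectrum; exists p.
by have [_ [->]] := clQ _ nQ.
Qed.

Lemma bot_notin_proper_filter {S : bPOrderType d} (F : set S) :
  is_filter (@ple d S) F -> F <> setT -> ~ F \bot.
Proof.
move=> fF FT F0; apply: FT; apply/seteqP; split=> // p _.
exact: filter_up fF F0 (le0x p).
Qed.

(** Otherwise the complement, an ideal, contains an upper bound [r] of [p] and [q]; but the join
    lies below [r], which forces [r] into [P]. *)
Lemma prime_filter_join {S : joinSemilatticeType d} (P : set S) (p q : S) :
  is_prime (@ple d S) P -> P (p `|` q) -> P p \/ P q.
Proof.
move=> [fP [_ iP]] Ppq; apply: contrapT => /not_orP npq.
have [r nPr [pr qr]] := (iP p q).1 npq.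
by apply: nPr; apply: (filter_up fP Ppq); rewrite leUx; apply/andP.
Qed.

Section Trace.
Context {S : bJoinSemilatticeType d} {prec : S -> S -> Prop}.

(** Equivalently, the union of the points of [C], seen as subsets of [S]. *)
Definition trace (C : set (spectrum prec)) : set S :=
  [set p | C `&` spec_open prec p !=set0].

(** A union of proper subsets may be everything; here the minimum is a common element that all
    points omit. It also witnesses that the complement of the trace is non-empty. *)
Lemma trace_bot (C : set (spectrum prec)) : ~ trace C \bot.
Proof.
move=> [Q [_ Q0]].
have [fQ _] := spec_prime Q.
exact: bot_notin_proper_filter fQ (@spec_proper _ _ _ Q) Q0.
Qed.

Lemma trace_proper (C : set (spectrum prec)) : trace C <> setT.
Proof. by move=> CT; apply: (@trace_bot C); rewrite CT. Qed.

Lemma trace_round (C : set (spectrum prec)) : is_round prec (trace C).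
Proof.
by move=> p [Q [CQ Qp]]; have [r Qr rp] := spec_round Qp; exists r => //; exists Q.
Qed.

Lemma trace_up (C : set (spectrum prec)) (p q : S) :
  trace C p -> p <= q -> trace C q.
Proof.
move=> [Q [CQ Qp]] pq; exists Q; split=> //.
by have [fQ _] := spec_prime Q; exact: filter_up fQ Qp pq.
Qed.

Lemma trace_prime (C : set (spectrum prec)) :
  irreducible_closed C -> is_prime (@ple d S) (trace C).
Proof.
move=> iC; split; split.
- have [Q CQ] := irreducible_closed_nonempty iC.
  by have [[[p Qp] _] _] := spec_prime Q; exists p, Q.
- move=> p q; split=> [[Cp Cq]|[r Cr [rp rq]]]; last first.
    by split; [exact: trace_up Cr rp|exact: trace_up Cr rq].
  have [Q [CQ [Qp Qq]]] := irreducible_closed_openI iC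
    (@spec_open_open _ _ p) (@spec_open_open _ _ q) Cp Cq.
  have [[_ fQ] _] := spec_prime Q.
  by have [r Qr rpq] := (fQ p q).1 (conj Qp Qq); exists r => //; exists Q.
- by exists \bot; exact: trace_bot.
- move=> p q; split=> [[nCp nCq]|[r nCr [pr qr]]]; last first.
    by split=> Cp; apply: nCr; [exact: trace_up Cp pr|exact: trace_up Cp qr].
  exists (p `|` q); last by split; [exact: leUl|exact: leUr].
  move=> [Q [CQ Qpq]].
  have [Qp|Qq] := prime_filter_join (spec_prime Q) Qpq.
  + by apply: nCp; exists Q.
  + by apply: nCq; exists Q.
Qed.

End Trace.
End Spectrum.

Theorem proposition1p4 (d : Order.disp_t) (S : bJoinSemilatticeType d)
    (prec : S -> S -> Prop) :
  sober (spectrum prec).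
Proof.
move=> C iC.
pose P := Spectrum (@trace_proper _ _ prec C) (@trace_round _ _ prec C)
  (trace_prime iC).
have cC : closed C := iC.1.
exists P; split.
  apply/seteqP; split=> Q => [CQ|/closure_spectrum1 QP].
    by apply/closure_spectrum1 => p Qp; exists Q.
  (* Any [Q] contained in the trace is a limit of [C]: each [p] in [Q] belongs to some [R] in
     [C]. *)
  by apply: cC => A /nbhs_spectrum [p /QP [R [CR Rp]] pA]; exists R; split=> //; exact: pA.
(* Uniqueness: if [C] is the closure of [Q], then [Q] is the largest point of [C], hence equal to
   the union of these points. *)
move=> Q CQ; apply: spectrum_eq; apply/seteqP; split.
- move=> p [R [CR Rp]]; move: CR; rewrite CQ => /closure_spectrum1; exact.
- have CQQ : C Q by rewrite CQ; exact: subset_closure.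
  by move=> p Qp; exists Q.
Qed.
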